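(* Let $k\ge 1$ be an integer and let $A(x),B(x)$ be the generating functions of valid trees defined in the context. Then \begin{align*} A(x)&= 1+\sum_{n\ge 1}\sum_{\lambda}\frac{1}{n}\, \frac{|\lambda|}{kn+1}\binom{n}{|\lambda|}\binom{kn+1}{\ell(\lambda)}\frac{\ell(\lambda)!}{m_\lambda}\mathbf{t}^{\lambda} x^n,\\ B(x) &=1+\sum_{n\ge 1}\sum_{\lambda} \frac{1}{n} \binom{n}{|\lambda|+1}\binom{kn}{\ell(\lambda)}\frac{\ell(\lambda)!}{m_\lambda}\mathbf{t}^{\lambda} x^n,\\ A(x)B(x)&=1+\sum_{n \ge 1}\sum_{\lambda} \frac{1}{n}\left(\binom{n}{|\lambda|+1}+\frac{|\lambda|}{kn+1}\binom{n+1}{|\lambda|+1}\right)\binom{kn+1}{\ell(\lambda)}\frac{\ell(\lambda)!}{m_\lambda}\mathbf{t}^{\lambda} x^n, \end{align*} where the inner sums run over all partitions $\lambda$ (including the empty partition).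
   Context: For a partition $\lambda$, $\ell(\lambda)$ is its number of parts, $|\lambda|$ the sum of its parts, $m_i(\lambda)$ the number of parts equal to $i$, and $m_\lambda=m_1(\lambda)!\,m_2(\lambda)!\cdots$. Let $K=\mathbb{C}(t_1,t_2,t_3,\ldots)$ be the field of rational functions in (finitely many of) the indeterminates $t_i$, and $\mathbf{t}^\lambda=t_1^{m_1(\lambda)}t_2^{m_2(\lambda)}t_3^{m_3(\lambda)}\cdots\in K$. Generating functions lie in $K[[x]]$. Binomial coefficients $\binom{a}{b}$ with $b<0$ or $b>a\ge 0$ are $0$. A rooted plane tree is a rooted tree in which each vertex has a linearly ordered list of children. For $0\le j\le k$ and $n\ge 0$, a $j$-rooted $(n,k)$-valid tree is a rooted plane tree with $(k+1)n$ edges and $(k+1)n+1$ vertices, whose vertices are labeled by consecutive integers in pre-order starting with label $j$ at the root, labels being considered modulo $k+1$, such that: every vertex with label $\equiv 1\pmod{k+1}$ has either $0$ or $k+1$ children; every vertex with label $\not\equiv 1\pmod{k+1}$ has $m(k+1)$ children for some nonnegative integer $m$. Its type is the partition formed by all positive $m$ (with repetition) such that some vertex in the latter category has $m(k+1)$ children. Let $S_j$ be the set of all $j$-rooted $(n,k)$-valid trees over all $n\ge 0$, and let \[ A_j(x)=\sum_{T\in S_j}\mathbf{t}^{\lambda(T)}x^{\nu(T)}, \] where $\lambda(T)$ is the type of $T$ and $\nu(T)$ is the $n$ such that $T$ has $(k+1)n$ edges. Then $A(x)$ denotes the common power series $A_0(x)=A_2(x)=A_3(x)=\cdots=A_k(x)$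 (so $A(x)=A_0(x)$), and $B(x)=A_1(x)$. *)

(* Defs.v *)
From HB Require Import structures.
From mathcomp Require Import all_boot all_order all_algebra.
From mathcomp Require Import finmap.
From mathcomp.multinomials Require Import monalg.
From mathcomp.real_closed Require Import complex.
From mathcomp Require Import boolp classical_sets cardinality fsbigop reals.

Set Implicit Arguments.
Unset Strict Implicit.
Unset Printing Implicit Defensive.

Import Order.TTheory GRing.Theory Num.Theory.

Local Open Scope ring_scope.

Definition ipoly (F : idomainType) : Type := {malg F[{cmonom nat}]}.

HB.instance Definition _ (F : idomainType) := GRing.ComNzRing.on (ipoly F).

Section IpolyDomain.
Variable F : idomainType.
Implicit Types (m : {cmonom nat}) (f g : ipoly F).

(* Kronecker weight: injective on the monomials in the indeterminates below N
   all of whose exponents are smaller than b. *)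
Definition kweight (b N : nat) m : nat := (\sum_(i < N) m (val i) * b ^ i)%N.

Lemma kweightM b N m1 m2 :
  kweight b N (mmul m1 m2) = (kweight b N m1 + kweight b N m2)%N.
Proof.
by rewrite /kweight -big_split /=; apply: eq_bigr => i _; rewrite cmM mulnDl.
Qed.

Lemma digits_inj b N (u v : nat -> nat) :
  (forall i, (u i < b)%N) -> (forall i, (v i < b)%N) ->
  (\sum_(i < N) u i * b ^ i = \sum_(i < N) v i * b ^ i)%N ->
  forall i, (i < N)%N -> u i = v i.
Proof.
elim: N u v => [|N IH] u v hu hv //.
have E (w : nat -> nat) : (\sum_(i < N.+1) w i * b ^ i =
    (\sum_(i < N) w i.+1 * b ^ i) * b + w 0)%N.
  rewrite big_ord_recl /= expn0 muln1 addnC big_distrl /=; congr (_ + _)%N.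
  by apply: eq_bigr => i _; rewrite /bump /= add1n expnSr mulnA.
rewrite !E => eq_uv.
have b_gt0 : (0 < b)%N by apply: leq_ltn_trans (hu 0%N).
have eq0 : u 0%N = v 0%N.
  have := congr1 (modn^~ b) eq_uv.
  by rewrite !modnMDl !modn_small.
have eqS : (\sum_(i < N) u i.+1 * b ^ i = \sum_(i < N) v i.+1 * b ^ i)%N.
  have := congr1 (divn^~ b) eq_uv.
  by rewrite !divnMDl // !divn_small // !addn0.
case=> [|i] // lt_iN.
by apply: (IH (fun i => u i.+1) (fun i => v i.+1)).
Qed.

Definition mbounded (b N : nat) m :=
  (forall i, (m i < b)%N) /\ (forall i, (N <= i)%N -> m i = 0%N).

Lemma mboundedW b N b' N' m :
  (b <= b')%N -> (N <= N')%N -> mbounded b N m -> mbounded b' N' m.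
Proof.
move=> hb hN [h1 h2]; split=> i.
  exact: leq_trans (h1 i) hb.
by move=> hi; apply: h2; apply: leq_trans hi.
Qed.

Lemma mbounded_ex m : exists b N, mbounded b N m.
Proof.
exists (\max_(i <- enum_fset (finsupp m)) m i).+1.
exists (\max_(i <- enum_fset (finsupp m)) i.+1); split=> i.
  rewrite ltnS; case: (mdomP m i) => // hi.
  by rewrite (big_fsetD1 i) //= leq_maxl.
move=> hi; apply/eqP; rewrite cmE_eq0; apply: contraTN hi => hi.
by rewrite -ltnNge (big_fsetD1 i) //= leq_maxl.
Qed.

Lemma mbounded_seq (s : seq {cmonom nat}) :
  exists b N, {in s, forall m, mbounded b N m}.
Proof.
elim: s => [|m s [b [N IH]]]; first by exists 0%N, 0%N.
have [b' [N' h]] := mbounded_ex m.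
exists (maxn b b'), (maxn N N') => m'; rewrite inE => /predU1P[->|hm'].
  by apply: mboundedW h; rewrite leq_maxr.
by apply: mboundedW (IH _ hm'); rewrite leq_maxl.
Qed.

Lemma kweight_inj b N m1 m2 : mbounded b N m1 -> mbounded b N m2 ->
  kweight b N m1 = kweight b N m2 -> m1 = m2.
Proof.
move=> [h1 h1'] [h2 h2'] /(digits_inj h1 h2) h; apply/eqP/cmP => i.
by have [/h//|hi] := ltnP i N; rewrite h1' ?h2'.
Qed.

Lemma msupp_max (w : {cmonom nat} -> nat) f : f != 0 ->
  exists2 m, m \in msupp f & {in msupp f, forall m', (w m' <= w m)%N}.
Proof.
rewrite -msupp_eq0 => /fset0Pn[m0 hm0].
have [m _ hm] := @arg_maxnP (msupp f) [` hm0]%fset xpredT (w \o val) isT.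
exists (val m); first exact: valP.
by move=> m' hm'; exact: (hm [` hm']%fset isT).
Qed.

Lemma ipoly_mulf_eq0 f g : f * g = 0 -> (f == 0) || (g == 0).
Proof.
move=> fg0; apply/orP; apply: contrapT => /not_orP[/negP f0 /negP g0].
have [b [N hbN]] := mbounded_seq (enum_fset (msupp f) ++ enum_fset (msupp g)).
have hf m : m \in msupp f -> mbounded b N m.
  by move=> h; apply: hbN; rewrite mem_cat; apply/orP; left.
have hg m : m \in msupp g -> mbounded b N m.
  by move=> h; apply: hbN; rewrite mem_cat; apply/orP; right.
have [m hm mmax] := msupp_max (kweight b N) f0.
have [p hp pmax] := msupp_max (kweight b N) g0.
have := congr1 (mcoeff (mmul m p)) fg0.
rewrite mcoeff0 mcoeffMl (big_fsetD1 m) //= (big_fsetD1 p) //= eqxx mulr1n.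
have inner (p' : {cmonom nat}) : p' \in (msupp g `\ p)%fset ->
    f@_m * g@_p' *+ (mmul m p' == mmul m p) = 0.
  rewrite in_fsetD1 => /andP[np' hp'].
  case: eqP => // /(congr1 (kweight b N)); rewrite !kweightM => /addnI.
  by move/(kweight_inj (hg _ hp') (hg _ hp)) => e; rewrite e eqxx in np'.
have outer (m' p' : {cmonom nat}) :
    m' \in (msupp f `\ m)%fset -> p' \in msupp g ->
    f@_m' * g@_p' *+ (mmul m' p' == mmul m p) = 0.
  rewrite in_fsetD1 => /andP[nm' hm'] hp'.
  case: eqP => // /(congr1 (kweight b N)); rewrite !kweightM => e.
  suff /(kweight_inj (hf _ hm') (hf _ hm)) e' :
      kweight b N m' = kweight b N m by rewrite e' eqxx in nm'.
  apply/eqP; rewrite eqn_leq mmax //=.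
  by rewrite -(leq_add2r (kweight b N p)) -e leq_add2l pmax.
rewrite [X in _ + X]big1_seq => [|m' /= hm']; last first.
  by apply: big1_seq => p' /= hp'; exact: outer.
rewrite addr0 big1_seq => [|p' /= hp']; last exact: inner.
rewrite addr0.
move/eqP; rewrite mulf_eq0 => /orP[] /eqP h.
  by move: hm; rewrite -mcoeff_neq0 h eqxx.
by move: hp; rewrite -mcoeff_neq0 h eqxx.
Qed.

Definition ipoly_unit : pred (ipoly F) := fun f => `[< exists g, g * f = 1 >].

Definition ipoly_inv f : ipoly F :=
  if pselect (exists g, g * f = 1) is left h then projT1 (cid h) else f.

Fact ipoly_mulVf : {in ipoly_unit, left_inverse 1 ipoly_inv *%R}.
Proof.
move=> f /asboolP h; rewrite /ipoly_inv; case: pselect => // h'.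
by case: cid.
Qed.

Fact ipoly_unitP f g : g * f = 1 -> ipoly_unit f.
Proof. by move=> h; apply/asboolP; exists g. Qed.

Fact ipoly_inv_out : {in [predC ipoly_unit], ipoly_inv =1 id}.
Proof. by move=> f /asboolPn h; rewrite /ipoly_inv; case: pselect. Qed.

HB.instance Definition _ := GRing.ComNzRing_hasMulInverse.Build (ipoly F)
  ipoly_mulVf ipoly_unitP ipoly_inv_out.

HB.instance Definition _ := GRing.ComUnitRing_isIntegral.Build (ipoly F)
  ipoly_mulf_eq0.

End IpolyDomain.

Definition ratfield (R : realType) : fieldType := {fraction (ipoly R[i])}.

(* The generators of the polynomial ring are numbered from 0, so t_i is the
   generator of index i - 1; t_0 is junk and is never used. *)
Definition tvar (R : realType) (i : nat) : ratfield R :=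
  FracField.tofrac (<< ucm i.-1 >> : ipoly R[i]).

(* f : fps K is the series with coefficient f n in degree n *)
Definition fps (K : nzRingType) : Type := nat -> K.

Definition fps_mul (K : nzRingType) (f g : fps K) : fps K :=
  fun n => \sum_(i < n.+1) f i * g (n - i)%N.

(* 1 + \sum_(n >= 1) (a n) x^n *)
Definition fps_onep (K : nzRingType) (a : nat -> K) : fps K :=
  fun n => if n == 0%N then 1 else a n.

Record intpart : Type := IntPart {
  parts :> seq nat;
  _ : sorted geq parts && (0%N \notin parts)
}.

HB.instance Definition _ := [isSub for parts].
HB.instance Definition _ := [Choice of intpart by <:].

Fact intpart_of_subproof (s : seq nat) :
  let s' := sort geq [seq m <- s | (0 < m)%N] in
  sorted geq s' && (0%N \notin s').
Proof.
by rewrite /= sort_sorted ?mem_sort ?mem_filter // => m n; exact: leq_total.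
Qed.

(* the partition formed by the positive terms of s, with repetition *)
Definition intpart_of (s : seq nat) : intpart :=
  IntPart (intpart_of_subproof s).

Definition plength (la : intpart) : nat := size la.
Definition psize (la : intpart) : nat := sumn la.
Definition pmult (i : nat) (la : intpart) : nat := count_mem i la.

(* m_la and t^la: every part of la is at most |la| *)
Definition pfact (la : intpart) : nat :=
  (\prod_(1 <= i < (psize la).+1) (pmult i la)`!)%N.

Definition tmon (R : realType) (la : intpart) : ratfield R :=
  \prod_(1 <= i < (psize la).+1) tvar R i ^+ pmult i la.

Inductive ptree : Type := PNode of seq ptree.

Definition children (T : ptree) : seq ptree := let: PNode ts := T in ts.

Fixpoint ptree_encode (T : ptree) : GenTree.tree unit :=
  let: PNode ts := T in GenTree.Node 0 (map ptree_encode ts).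

Fixpoint ptree_decode (t : GenTree.tree unit) : ptree :=
  if t is GenTree.Node _ ts then PNode (map ptree_decode ts) else PNode [::].

Fact ptree_encodeK : cancel ptree_encode ptree_decode.
Proof.
rewrite /cancel; fix IH 1; case=> ts /=; congr PNode.
by elim: ts => //= T ts ->; rewrite IH.
Qed.

HB.instance Definition _ := Choice.copy ptree (can_type ptree_encodeK).

(* The vertices of T in pre-order, each one represented by the subtree of its
   descendants (distinct vertices may carry equal subtrees). *)
Fixpoint vertices (T : ptree) : seq ptree :=
  let: PNode ts := T in T :: flatten (map vertices ts).

Definition nvertices (T : ptree) : nat := size (vertices T).

(* number of children of the i-th vertex in pre-order, counting from 0 *)
Definition nchildren (T : ptree) (i : nat) : nat :=
  size (children (nth (PNode [::]) (vertices T) i)).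

Definition nedges (T : ptree) : nat :=
  sumn [seq nchildren T i | i <- iota 0 (nvertices T)].

(* In a j-rooted tree the i-th vertex in pre-order has label j + i. *)
Definition label1 (j k i : nat) : bool := ((j + i)%N == 1 %[mod k.+1])%N.

Definition valid_tree (j n k : nat) (T : ptree) : bool :=
  [&& nedges T == (k.+1 * n)%N,
      nvertices T == (k.+1 * n).+1 &
      all (fun i => let d := nchildren T i in
             if label1 j k i then (d == 0%N) || (d == k.+1) else (k.+1 %| d)%N)
          (iota 0 (nvertices T))].

Definition tree_type (j k : nat) (T : ptree) : intpart :=
  intpart_of [seq (nchildren T i %/ k.+1)%N
             | i <- iota 0 (nvertices T) & ~~ label1 j k i].

(* The coefficient of x^n is a sum over the finitely many j-rooted
   (n, k)-valid trees. *)
Definition treeGF (R : realType) (k j : nat) : fps (ratfield R) :=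
  fun n => \sum_(T \in [set T | valid_tree j n k T]%classic)
             tmon R (tree_type j k T).

Definition Aseries (R : realType) (k : nat) := treeGF R k 0.
Definition Bseries (R : realType) (k : nat) := treeGF R k 1.

(* Main.v *)
(* Removing the first root of an ordered forest with L + 1 trees and v + 1
   vertices leaves a forest with L + d trees and v vertices, d being the number
   of children of that root, whose first label is one larger.  This recursion
   makes the weighted forest sums multiplicative in the number of trees, and
   since every subtree has size 1 modulo k + 1, the k + 1 consecutive children
   in a group carry each residue once.  Hence, with y = x A^k B and
   T(u) = 1 + t_1 u + t_2 u^2 + ..., B = 1 + y and A = T(y), that is,
   y = x phi(y) with phi(u) = T(u)^k (1 + u).  The three formulas are Lagrange
   inversion for H = T, 1 + u and T (1 + u), together with the expansion of the
   powers of T over partitions.  Power series are handled as polynomials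
   modulo x^M. *)
Require Import Defs.
From HB Require Import structures.
From mathcomp Require Import all_boot all_order all_algebra.
From mathcomp.multinomials Require Import monalg.
From mathcomp.real_closed Require Import complex.
From mathcomp Require Import ring zify.
From mathcomp Require Import boolp classical_sets cardinality fsbigop reals.

Set Implicit Arguments.
Unset Strict Implicit.
Unset Printing Implicit Defensive.

Import Order.TTheory GRing.Theory Num.Theory.

Local Open Scope ring_scope.

(** * Polynomials modulo x^M and Lagrange inversion *)

Definition eqX (K : comNzRingType) (M : nat) (p q : {poly K}) :=
  forall i, (i < M)%N -> p`_i = q`_i.

Section EqX.
Variables (K : comNzRingType) (M : nat).
Implicit Types p q r : {poly K}.

Lemma eqX_sym p q : eqX M p q -> eqX M q p.
Proof. by move=> h i /h. Qed.

Lemma eqX_trans p q r : eqX M p q -> eqX M q r -> eqX M p r.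
Proof. by move=> h1 h2 i hi; rewrite h1 // h2. Qed.

Lemma eqXM p1 q1 p2 q2 :
  eqX M p1 q1 -> eqX M p2 q2 -> eqX M (p1 * p2) (q1 * q2).
Proof.
move=> h1 h2 i hi; rewrite !coefM; apply: eq_bigr => j _.
rewrite h1 ?h2 //; last exact: leq_trans (ltn_ord j) hi.
exact: leq_ltn_trans (leq_subr _ _) hi.
Qed.

Lemma eqXX p q n : eqX M p q -> eqX M (p ^+ n) (q ^+ n).
Proof.
by move=> h; elim: n => [|n IH]; rewrite ?expr0 // !exprS; exact: eqXM.
Qed.

Lemma eqX_sum (I : Type) (s : seq I) (F F' : I -> {poly K}) :
  (forall i, eqX M (F i) (F' i)) ->
  eqX M (\sum_(i <- s) F i) (\sum_(i <- s) F' i).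
Proof.
by move=> h i hi; rewrite !coef_sum; apply: eq_bigr => j _; exact: h.
Qed.

End EqX.

Lemma comp_poly_exp (K : comNzRingType) (p q : {poly K}) n :
  p ^+ n \Po q = (p \Po q) ^+ n.
Proof. by elim: n => [|n IH]; rewrite ?comp_polyC // !exprS comp_polyM IH. Qed.

(* Strong induction on n: for H = u^m the coefficient [x^n] y^m equals
   [x^(n-m)] phi(y)^m, to which the induction hypothesis applies with
   H = phi^m. *)
Lemma lagrange_inversion (K : fieldType) (M : nat) (y phi : {poly K}) :
  [pchar K] =i pred0 -> eqX M y ('X * (phi \Po y)) ->
  forall (n : nat) (H : {poly K}), (0 < n)%N -> (n < M)%N ->
  (H \Po y)`_n *+ n = (H^`() * phi ^+ n)`_n.-1.
Proof.
move=> /pcharf0P char0 hy n; elim/ltn_ind: n => n IH H n_gt0 ltnM.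
rewrite comp_polyE -[in RHS](coefK H) poly_def raddf_sum /= mulr_suml !coef_sum.
rewrite -sumrMnl; apply: eq_bigr => m _.
rewrite derivZ -scalerAl !coefZ -mulrnAr; congr (_ * _).
rewrite derivXn mulrnAl coefMn coefXnM.
move: (nat_of_ord m) => {m} [|m].
  by rewrite expr0 mulr0n coef1 gtn_eqF ?mul0rn.
have -> : (y ^+ m.+1)`_n = ('X^(m.+1) * (phi ^+ m.+1 \Po y))`_n.
  by rewrite comp_poly_exp -exprMn; apply: (eqXX _ hy).
rewrite coefXnM [m.+1.-1]/=.
case: n IH n_gt0 ltnM => // n IH _ ltnM; rewrite ltnS subSS [n.+1.-1]/=.
case: ltngtP => [_|ltmn|->]; first by rewrite !mul0rn.
  have d_gt0 : (0 < n - m)%N by rewrite subn_gt0.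
  (* The induction hypothesis only controls [n - m] times the coefficient, so both sides are
     multiplied by this factor, which is invertible in characteristic 0. *)
  apply: (mulIf (x := (n - m)%:R)); first by rewrite char0 -lt0n.
  rewrite !mulr_natr -mulrnA mulnC mulrnA IH //; last 2 first.
  - by rewrite ltnS leq_subr.
  - by apply: leq_ltn_trans ltnM; rewrite (leq_trans (leq_subr _ _)).
  rewrite deriv_exp mulrnAl -mulrA -exprD [m.+1.-1]/= subnKC 1?ltnW //.
  have := coef_deriv (phi ^+ n.+1) (n - m).-1.
  rewrite deriv_exp coefMn [n.+1.-1]/= prednK // coefMn => e.
  by rewrite -mulrnA mulnC mulrnA e -mulrnA mulnC mulrnA.
(* Here only the constant term of phi(y) matters, and it is that of phi because y(0) = 0. *)
rewrite subnn; congr (_ *+ _).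
have M_gt0 : (0 < M)%N by apply: leq_ltn_trans ltnM.
rewrite -horner_coef0 horner_comp.
by rewrite horner_coef0 hy // coefXM horner_coef0.
Qed.

(** * Partitions with bounded parts and powers of T *)

(** Choosing the multiplicity [c] of the largest part first mirrors the binomial expansion in
    [tpoly_exp]. [M] bounds each multiplicity, not the length; sequences that are too long get
    weight 0 there. *)
Fixpoint partseqs (M m : nat) : seq (seq nat) :=
  if m is m'.+1 then
    [seq nseq c m ++ s | c <- iota 0 M.+1, s <- partseqs M m']
  else [:: [::]].

Lemma partseqsP M m s : s \in partseqs M m ->
  sorted geq s /\ {in s, forall i, (0 < i <= m)%N}.
Proof.
elim: m s => [|m IH] s; first by rewrite inE => /eqP ->.
case/allpairsPdep=> c [s' [_ /IH[hs' hm] ->]]; split.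
  case: c => [|c] //=; rewrite cat_path; apply/andP; split.
    by elim: c => //= c ->; rewrite leqnn.
  have -> : last m.+1 (nseq c m.+1) = m.+1 by elim: c.
  case: s' hs' hm => //= a s' -> ha; rewrite andbT.
  by have /andP[_ /leqW] := ha a (mem_head _ _).
move=> i; rewrite mem_cat => /orP[|/hm /andP[-> /leqW] //].
by rewrite mem_nseq => /andP[_ /eqP ->]; rewrite leqnn.
Qed.

Lemma count_cat_nseq m c (s : seq nat) : {in s, forall i, (i <= m)%N} ->
  count_mem m.+1 (nseq c m.+1 ++ s) = c.
Proof.
move=> hs; rewrite count_cat count_nseq /= eqxx mul1n.
rewrite (@eq_in_count _ _ pred0) ?count_pred0 ?addn0 // => i /hs.
by rewrite -ltnS => /ltn_eqF.
Qed.

Lemma partseqs_uniq M m : uniq (partseqs M m).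
Proof.
elim: m => // m IH; apply: allpairs_uniq_dep => //; first exact: iota_uniq.
case=> c s [c' s'] /allpairsPdep[c1 [s1 [_ /partseqsP[_ h1] [-> ->]]]].
case/allpairsPdep=> c2 [s2 [_ /partseqsP[_ h2] [-> ->]]] /= e.
have hc : c1 = c2.
  rewrite -(@count_cat_nseq m c1 s1) => [|i /h1/andP[] //].
  by rewrite e count_cat_nseq // => i /h2/andP[].
by move/eqP: e; rewrite hc eqseq_cat // eqxx => /eqP ->.
Qed.

Lemma mem_partseqs M m (s : seq nat) : sorted geq s -> 0%N \notin s ->
  {in s, forall i, (i <= m)%N} -> (size s <= M)%N -> s \in partseqs M m.
Proof.
elim: m s => [|m IH] s srt s0 hm hM.
  case: s srt s0 hm hM => //= a s _.
  rewrite inE negb_or => /andP[a0 _] hm.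
  by have := hm a (mem_head _ _); rewrite leqn0 eq_sym (negbTE a0).
pose c := count_mem m.+1 s; pose s' := [seq i <- s | i != m.+1].
(* In a nonincreasing sequence bounded by [m.+1], all copies of [m.+1] come first. *)
have hs : s = nseq c m.+1 ++ s'.
  rewrite /c /s' {c s'}; clear IH s0 hM; elim: s srt hm => //= a s IHs srt hm.
  have hm' : {in s, forall i, (i <= m.+1)%N}.
    by move=> i hi; apply: hm; rewrite inE hi orbT.
  have := IHs (path_sorted srt) hm'.
  have [-> /= <- //|na _] := eqVneq a m.+1.
  have a_le : (a <= m)%N.
    by rewrite -ltnS ltn_neqAle na hm // mem_head.
  have hs : {in s, forall i, i != m.+1}.
    move=> i hi; rewrite ltn_eqF // ltnS; apply: leq_trans a_le.
    have tr : transitive geq by move=> x y z h1 h2; apply: leq_trans h2 h1.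
    by have /allP/(_ i hi) := order_path_min tr srt.
  rewrite /= (eq_in_filter (a2 := predT)) ?filter_predT; last first.
    by move=> i /hs ->.
  by rewrite (@eq_in_count _ _ pred0) ?count_pred0 // => i /hs /negbTE.
rewrite [s]hs; apply: allpairs_f_dep; last first.
  apply: IH.
  - by apply: sorted_filter => // x y z h1 h2; apply: leq_trans h2 h1.
  - by rewrite mem_filter (negbTE s0) andbF.
  - move=> i; rewrite mem_filter => /andP[ni /hm].
    by rewrite leq_eqVlt (negbTE ni).
  - by apply: leq_trans hM; rewrite size_filter count_size.
by rewrite mem_iota /= add0n ltnS (leq_trans _ hM) // count_size.
Qed.

Definition cntfact (m : nat) (s : seq nat) : nat :=
  (\prod_(1 <= i < m.+1) (count_mem i s)`!)%N.

Lemma cntfactS m c (s : seq nat) : {in s, forall i, (i <= m)%N} ->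
  cntfact m.+1 (nseq c m.+1 ++ s) = (cntfact m s * c`!)%N.
Proof.
move=> hs; rewrite /cntfact big_nat_recr //= count_cat_nseq //.
congr (_ * _)%N; apply: eq_big_nat => i /andP[_ hi].
by rewrite count_cat count_nseq /= eq_sym ltn_eqF // mul0n.
Qed.

Lemma ffactD n a b : (n ^_ (a + b) = n ^_ a * (n - a) ^_ b)%N.
Proof.
elim: a n => [|a IH] n; first by rewrite ffactn0 mul1n subn0.
by rewrite addSn !ffactnS IH -subn1 -subnDA add1n mulnA.
Qed.

Definition tpoly (K : comNzRingType) (t : nat -> K) (m : nat) : {poly K} :=
  \sum_(i < m.+1) t i *: 'X^i.

Section Multinomial.
Variables (K : fieldType) (t : nat -> K).
Hypotheses (t0 : t 0%N = 1) (char0 : [pchar K] =i pred0).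

Lemma natfact_neq0 n : n`!%:R != 0 :> K.
Proof. by move/pcharf0P: char0 => ->; rewrite -lt0n fact_gt0. Qed.

Lemma cntfact_neq0 m s : (cntfact m s)%:R != 0 :> K.
Proof.
move/pcharf0P: char0 => ->; rewrite -lt0n prodn_gt0 // => i.
exact: fact_gt0.
Qed.

(** The multinomial coefficient for choosing the terms of [s] among [r] factors T, the other factors
    giving [t 0 = 1], times the monomial of [s]. *)
Definition mnweight (m r : nat) (s : seq nat) : K :=
  (r ^_ (size s))%:R / (cntfact m s)%:R * \prod_(i <- s) t i.

(** Induction on the degree of the truncation: the binomial theorem splits off the top term, whose
    exponent [c] is the multiplicity of the part [m.+1]. *)
Lemma tpoly_exp M m r : (r <= M)%N ->
  tpoly t m ^+ r = \sum_(s <- partseqs M m) mnweight m r s *: 'X^(sumn s).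
Proof.
elim: m r => [|m IH] r hr.
  rewrite /tpoly big_ord_recl big_ord0 addr0 t0 scale1r expr0 expr1n.
  by rewrite big_seq1 /mnweight /cntfact big_nil big_geq // divr1 mulr1 scale1r.
rewrite [partseqs M m.+1]/partseqs -/partseqs big_allpairs_dep.
rewrite -[iota 0 M.+1]/(index_iota 0 M.+1).
have -> : tpoly t m.+1 = tpoly t m + t m.+1 *: 'X^(m.+1).
  by rewrite /tpoly big_ord_recr.
rewrite big_mkord exprDn (big_ord_widen_cond M.+1 xpredT
  (fun i => (tpoly t m ^+ (r - i) * (t m.+1 *: 'X^(m.+1)) ^+ i) *+ 'C(r, i))) //.
rewrite big_mkcond /=; apply: eq_bigr => -[c hc] _ /=.
(* For [r < c] the falling factorial vanishes, so the binomial sum may run up to [M]. *)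
case: ltnP => [|lt_rc]; last first.
  rewrite big1_seq // => s _.
  rewrite /mnweight size_cat size_nseq ffact_small ?mul0r ?scale0r //.
  by apply: leq_trans lt_rc _; rewrite leq_addr.
rewrite ltnS => le_cr; rewrite IH ?(leq_trans (leq_subr _ _)) //.
rewrite mulr_suml -sumrMnl !big_seq; apply: eq_bigr => s hs.
have {}hs : {in s, forall i, (i <= m)%N}.
  by have [_ h] := partseqsP hs => i /h/andP[].
rewrite exprZn -exprM -scalerAl -scalerAr scalerA -exprD scalerMnl.
rewrite sumn_cat sumn_nseq [(_ + sumn s)%N]addnC; congr (_ *: _).
rewrite /mnweight big_cat /= cntfactS // size_cat size_nseq.
have -> : \prod_(i <- nseq c m.+1) t i = t m.+1 ^+ c.
  by rewrite big_nseq -Monoid.iteropE.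
rewrite ffactD natrM natrM.
rewrite -(bin_ffact r c) natrM -[_ *+ 'C(r, c)]mulr_natr.
have := natfact_neq0 c; have := cntfact_neq0 m s.
by move: (_`!%:R) ((cntfact m s)%:R) => a b b0 a0; field; apply/andP.
Qed.

End Multinomial.

(** * Degree sequences and enumeration of ordered forests *)

Definition degseq (T : ptree) : seq nat :=
  [seq size (children v) | v <- vertices T].

Definition fdegseq (F : seq ptree) : seq nat := flatten (map degseq F).

Lemma degseqE ts : degseq (PNode ts) = size ts :: fdegseq ts.
Proof. by rewrite /degseq /= map_flatten -map_comp. Qed.

Lemma fdegseq_cat F1 F2 : fdegseq (F1 ++ F2) = fdegseq F1 ++ fdegseq F2.
Proof. by rewrite /fdegseq map_cat flatten_cat. Qed.

Lemma fdegseq_cons ts F :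
  fdegseq (PNode ts :: F) = size ts :: fdegseq (ts ++ F).
Proof. by rewrite fdegseq_cat /fdegseq map_cons degseqE. Qed.

Lemma size_degseq T : size (degseq T) = nvertices T.
Proof. by rewrite size_map. Qed.

Lemma nchildrenE T i : nchildren T i = nth 0%N (degseq T) i.
Proof.
rewrite /nchildren; have [h|h] := ltnP i (nvertices T).
  by rewrite (nth_map (PNode [::])).
by rewrite !nth_default // size_degseq.
Qed.

Lemma nedgesE T : nedges T = sumn (degseq T).
Proof.
rewrite /nedges; congr sumn; rewrite -size_degseq.
rewrite -[RHS](mkseq_nth 0%N) /mkseq; apply: eq_map => i.
exact: nchildrenE.
Qed.

Lemma size_fdegseq (F : seq ptree) :
  size (fdegseq F) = (size F + sumn (fdegseq F))%N.
Proof.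
suff h T : size (degseq T) = (sumn (degseq T)).+1.
  elim: F => //= T F IH; rewrite /fdegseq /= -/(fdegseq F).
  by rewrite size_cat sumn_cat h IH; lia.
move: T; fix IHT 1; case=> ts; rewrite degseqE /=; congr _.+1.
elim: ts => //= T ts IH; rewrite /fdegseq /= -/(fdegseq ts).
by rewrite size_cat sumn_cat IHT IH; lia.
Qed.

Lemma nvertices_nedges T : nvertices T = (nedges T).+1.
Proof.
have := size_fdegseq [:: T].
by rewrite /fdegseq /= cats0 size_degseq nedgesE.
Qed.

(* The ordered forests of L trees with v vertices, obtained by adding a root
   whose children are the first d trees of a smaller forest. *)
Fixpoint forests (v L : nat) : seq (seq ptree) :=
  match v, L with
  | 0, 0 => [:: [::]]
  | v'.+1, L'.+1 =>
      [seq PNode (take d F) :: drop d F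
      | d <- iota 0 v'.+1, F <- forests v' (d + L')]
  | _, _ => [::]
  end.

Lemma forestsSS v L : forests v.+1 L.+1 =
  [seq PNode (take d F) :: drop d F
  | d <- iota 0 v.+1, F <- forests v (d + L)].
Proof. by []. Qed.

Lemma mem_forests v L F :
  (F \in forests v L) = (size F == L) && (size (fdegseq F) == v).
Proof.
elim: v L F => [|v IH] [|L] F.
- by rewrite inE; case: F => // -[ts] F; rewrite fdegseq_cons.
- by rewrite in_nil; case: F => // -[ts] F; rewrite fdegseq_cons andbF.
- by rewrite in_nil; case: F.
apply/idP/idP.
  rewrite forestsSS => /allpairsPdep[d [G [_ hG ->]]].
  move: hG; rewrite IH => /andP[/eqP hs /eqP hv].
  rewrite fdegseq_cons cat_take_drop /=.
  by rewrite hv size_drop hs addKn !eqxx.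
case: F => // -[ts] F /andP[/eqP[hF]]; rewrite fdegseq_cons => /eqP[hv].
have -> : PNode ts :: F =
    PNode (take (size ts) (ts ++ F)) :: drop (size ts) (ts ++ F).
  by rewrite take_size_cat // drop_size_cat.
rewrite forestsSS; apply: allpairs_f_dep.
  (* The bound on the root degree in [forests] loses nothing: the remaining forest has at least as
     many vertices as the removed root had children. *)
  rewrite mem_iota /= add0n ltnS -hv size_fdegseq size_cat -addnA.
  exact: leq_addr.
by rewrite IH size_cat hF hv !eqxx.
Qed.

Lemma forests_uniq v L : uniq (forests v L).
Proof.
elim: v L => [|v IH] [|L] //; rewrite forestsSS.
apply: allpairs_uniq_dep => //; first exact: iota_uniq.
case=> d F [d' F'] /allpairsPdep[d1 [F1 [_ h1 [-> ->]]]].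
case/allpairsPdep=> d2 [F2 [_ h2 [-> ->]]] /= [et ed].
move: h1 h2; rewrite !mem_forests => /andP[/eqP s1 _] /andP[/eqP s2 _].
(* The smaller forests have [d + L] trees, so [take] is not cut short and [d] is recovered as the
   root degree. *)
have e : d1 = d2.
  by move/(congr1 size): et; rewrite !size_takel // ?s1 ?s2 leq_addr.
by rewrite e in et ed *; rewrite -(cat_take_drop d2 F1) et ed cat_take_drop.
Qed.

(** * Weighted forest sums and their multiplicativity *)

Section ForestSums.
Variables (K : comNzRingType) (c : nat -> nat -> K).

(** [c j d] is the weight of a vertex with label [j] and [d] children; labels grow by one along the
    pre-order. *)
Fixpoint dweight (j : nat) (s : seq nat) : K :=
  if s is d :: s' then c j d * dweight j.+1 s' else 1.

Lemma dweightE j s :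
  dweight j s = \prod_(i <- iota 0 (size s)) c (j + i) (nth 0%N s i).
Proof.
elim: s j => [|d s IH] j; first by rewrite big_nil.
rewrite [LHS]/= IH /= big_cons addn0 /=; congr (_ * _).
rewrite (iotaDl 1 0) big_map; apply: eq_bigr => i _.
by rewrite addnS addSn.
Qed.

Definition fsum (v j L : nat) : K :=
  \sum_(F <- forests v L) dweight j (fdegseq F).

Lemma fsum00 j : fsum 0 j 0 = 1.
Proof. by rewrite /fsum big_seq1. Qed.

Lemma fsum_gt v j L : (v < L)%N -> fsum v j L = 0.
Proof.
move=> h; rewrite /fsum big1_seq // => F /=; rewrite mem_forests.
case/andP=> /eqP sF; rewrite size_fdegseq sF => /eqP e.
by move: h; rewrite -e ltnNge leq_addr.
Qed.

Lemma fsum0 v j : fsum v.+1 j 0 = 0.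
Proof. by rewrite /fsum big_nil. Qed.

Lemma fsumSS v j L :
  fsum v.+1 j L.+1 = \sum_(d < v.+1) c j d * fsum v j.+1 (d + L).
Proof.
rewrite /fsum forestsSS big_allpairs_dep.
rewrite -[iota 0 v.+1]/(index_iota 0 v.+1) big_mkord; apply: eq_bigr => d _.
rewrite mulr_sumr !big_seq; apply: eq_bigr => F; rewrite mem_forests.
case/andP=> /eqP sF _; rewrite fdegseq_cons cat_take_drop /=.
by rewrite size_takel // sF leq_addr.
Qed.

Lemma fsumSS_widen D v j L : (v <= D)%N ->
  fsum v.+1 j L.+1 = \sum_(d < D.+1) c j d * fsum v j.+1 (d + L).
Proof.
move=> le_vD; rewrite fsumSS.
rewrite (big_ord_widen _ (fun d => c j d * fsum v j.+1 (d + L))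
  (le_vD : (v < D.+1)%N)).
rewrite big_mkcond; apply: eq_bigr => d _; case: ltnP => // h.
by rewrite fsum_gt ?mulr0 // (leq_trans h) ?leq_addr.
Qed.

(** Cut the forest after its first [L1] trees: they use up [a] labels, so the rest starts at
    [j + a]. Root removal gives the induction on [v]. *)
Lemma fsumD v j L1 L2 :
  fsum v j (L1 + L2) =
  \sum_(a < v.+1) fsum a j L1 * fsum (v - a) (j + a) L2.
Proof.
elim: v j L1 => [|v IH] j [|L1]; rewrite big_ord_recl addn0 subn0
  ?fsum00 ?mul1r.
- by rewrite big_ord0 addr0 add0n.
- by rewrite big_ord0 addr0 !(@fsum_gt _ _ L1.+1) ?mul0r ?fsum_gt.
- by rewrite add0n big1 ?addr0 // => a _; rewrite lift0 fsum0 mul0r.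
rewrite [fsum (nat_of_ord ord0) _ _]fsum_gt // mul0r add0r addSn fsumSS.
under eq_bigr => d _ do rewrite addnA IH mulr_sumr.
rewrite exchange_big; apply: eq_bigr => a _.
have le_av : (a <= v)%N by rewrite -ltnS.
(* The degree range is widened from [a] to [v] so that it no longer depends on [a] and the two
   double sums match. *)
rewrite !lift0 (fsumSS_widen j L1 le_av) mulr_suml; apply: eq_bigr => d _.
by rewrite subSS addSnnS mulrA.
Qed.

End ForestSums.

Lemma sum_ord_support (K : comNzRingType) (V n : nat) (f : nat -> nat)
    (h : nat -> K) :
  injective f -> (forall i, (i < n)%N -> (f i < V)%N) ->
  (forall a, (a < V)%N -> h a != 0 -> exists2 i, (i < n)%N & a = f i) ->
  \sum_(a < V) h a = \sum_(i < n) h (f i).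
Proof.
move=> f_inj fV hf; pose s := map f (iota 0 n).
rewrite -(big_mkord xpredT h) -(big_mkord xpredT (h \o f)) /index_iota !subn0.
rewrite -(big_map f xpredT h) -/s.
transitivity (\sum_(a <- iota 0 V | a \in s) h a).
  rewrite [RHS]big_mkcond !big_seq; apply: eq_bigr => a.
  rewrite mem_iota => /= aV; case: ifPn => // nas; apply/eqP.
  apply: contraNT nas => /(hf a aV)[i hi ->].
  by rewrite map_f // mem_iota.
rewrite -[LHS]big_filter; apply: perm_big; apply: uniq_perm.
- by rewrite filter_uniq ?iota_uniq.
- by rewrite map_inj_uniq ?iota_uniq.
move=> a; rewrite mem_filter; case: (boolP (a \in s)) => //= /mapP[b].
by rewrite mem_iota => /fV hb ->; rewrite mem_iota.
Qed.

(** * Valid trees and their functional equation *)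

Section Valid.
Variables (K : comNzRingType) (t : nat -> K) (k : nat).

(* The factor contributed by a vertex with label j and d children; t 0 = 1
   accounts for the leaves. *)
Definition vweight (j d : nat) : K :=
  if (j == 1 %[mod k.+1])%N then ((d == 0%N) || (d == k.+1))%:R
  else if (k.+1 %| d)%N then t (d %/ k.+1)%N else 0.

Lemma vweight_period j d : vweight (j + k.+1) d = vweight j d.
Proof. by rewrite /vweight modnDr. Qed.

Lemma vweight_ndvd j d : ~~ (k.+1 %| d)%N -> vweight j d = 0.
Proof.
rewrite /vweight => h; rewrite (negbTE h); case: ifP => // _.
case: eqP => [e|_]; first by rewrite e dvdn0 in h.
by case: eqP => // e; rewrite e dvdnn in h.
Qed.

Lemma dweight_period j s : dweight vweight (j + k.+1) s = dweight vweight j s.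
Proof.
by elim: s j => //= d s IH j; rewrite vweight_period -addSn IH.
Qed.

Lemma dweight_ndvd j s : ~~ (k.+1 %| sumn s)%N -> dweight vweight j s = 0.
Proof.
elim: s j => [|d s IH] j; first by rewrite dvdn0.
rewrite [sumn _]/= [dweight _ _ _]/=.
have [hd|hd] := boolP (k.+1 %| d)%N; last by rewrite vweight_ndvd ?mul0r.
by rewrite dvdn_addr // => /IH ->; rewrite mulr0.
Qed.

Lemma fsum_period v j L : fsum vweight v (j + k.+1) L = fsum vweight v j L.
Proof. by apply: eq_bigr => F _; rewrite dweight_period. Qed.

(** A forest of [L] trees on [v] vertices has [v - L] edges, and a nonzero weight forces every
    degree to be a multiple of [k.+1]. *)
Lemma fsum_ndvd v j L : ~~ (k.+1 %| v - L)%N -> fsum vweight v j L = 0.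
Proof.
move=> h; rewrite /fsum big1_seq // => F /=; rewrite mem_forests.
case/andP=> /eqP sF /eqP vF; apply: dweight_ndvd.
by move: h; rewrite -vF size_fdegseq sF addKn.
Qed.

Lemma fsum_neq0 v j L : fsum vweight v j L != 0 ->
  exists i, v = (k.+1 * i + L)%N.
Proof.
have [h|h] := leqP L v; last by rewrite fsum_gt ?eqxx.
have [/dvdnP[i e] _|h'] := boolP (k.+1 %| v - L)%N; last first.
  by rewrite fsum_ndvd ?eqxx.
by exists i; rewrite mulnC -e subnK.
Qed.

(* Ordered forests with k.+1 * n edges in all. *)
Definition vsum (n j L : nat) : K := fsum vweight (k.+1 * n + L) j L.

Lemma vsum_period n j L : vsum n (j + k.+1) L = vsum n j L.
Proof. exact: fsum_period. Qed.

Lemma vsum_periodM n j m L : vsum n (j + k.+1 * m) L = vsum n j L.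
Proof.
elim: m => [|m IH]; first by rewrite muln0 addn0.
by rewrite mulnS [(k.+1 + _)%N]addnC addnA vsum_period.
Qed.

Lemma vsum0 n j : vsum n j 0 = (n == 0%N)%:R.
Proof.
case: n => [|n]; first by rewrite /vsum muln0 fsum00.
by rewrite /vsum mulnS addn0 addSn fsum0.
Qed.

(** The first [L1] trees have [k.+1 * i + L1] vertices, which is [L1] modulo [k.+1]. The label shift
    is thus independent of [i], and [fsumD] becomes a convolution in the exponent of x. *)
Lemma vsumD n j L1 L2 :
  vsum n j (L1 + L2) =
  \sum_(i < n.+1) vsum i j L1 * vsum (n - i) (j + L1) L2.
Proof.
rewrite /vsum fsumD; set V := (_ + _)%N.
rewrite (@sum_ord_support _ _ n.+1 (fun i => k.+1 * i + L1)%N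
  (fun a => fsum vweight a j L1 * fsum vweight (V - a) (j + a) L2)).
- apply: eq_bigr => -[i hi] _ /=; congr (_ * _).
  have -> : (V - (k.+1 * i + L1) = k.+1 * (n - i) + L2)%N by rewrite /V; nia.
  by rewrite [(k.+1 * i + _)%N]addnC addnA; exact: vsum_periodM.
- by move=> i1 i2 /eqP; rewrite eqn_add2r eqn_pmul2l // => /eqP.
- by move=> i hi; rewrite /V; nia.
move=> a aV h0.
have /fsum_neq0[i ei] : fsum vweight a j L1 != 0.
  by apply: contraNneq h0 => ->; rewrite mul0r.
have /fsum_neq0[i' ei'] : fsum vweight (V - a) (j + a) L2 != 0.
  by apply: contraNneq h0 => ->; rewrite mulr0.
exists i => //; rewrite ltnS -(leq_pmul2l (ltn0Sn k)).
by rewrite /V in aV ei'; lia.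
Qed.

Lemma vsumS n j :
  vsum n j 1 =
  \sum_(m < n.+1) vweight j (k.+1 * m) * vsum (n - m) j.+1 (k.+1 * m).
Proof.
rewrite /vsum addn1 fsumSS.
rewrite (@sum_ord_support _ _ n.+1 (muln k.+1)
  (fun d => vweight j d * fsum vweight (k.+1 * n) j.+1 (d + 0))).
- apply: eq_bigr => -[i hi] _ /=; rewrite addn0; congr (_ * fsum _ _ _ _).
  by rewrite -mulnDr subnK.
- by move=> i1 i2 /eqP; rewrite eqn_pmul2l // => /eqP.
- by move=> i hi; rewrite ltnS leq_pmul2l.
move=> a aV; have [/dvdnP[i e] _|h] := boolP (k.+1 %| a)%N; last first.
  by rewrite vweight_ndvd // mul0r eqxx.
exists i; rewrite 1?mulnC // -ltnS.
by move: aV; rewrite e !ltnS mulnC leq_pmul2l.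
Qed.

Section Truncation.
Variable M : nat.

Definition vpoly (j L : nat) : {poly K} := \poly_(n < M) vsum n j L.

Lemma coef_vpoly j L n : (n < M)%N -> (vpoly j L)`_n = vsum n j L.
Proof. by move=> h; rewrite coef_poly h. Qed.

Lemma vpoly_period j L : vpoly (j + k.+1) L = vpoly j L.
Proof.
by apply/polyP => i; rewrite !coef_poly; case: ifP => // _; exact: vsum_period.
Qed.

Lemma vpoly0 j : eqX M (vpoly j 0) 1.
Proof. by move=> n hn; rewrite coef_vpoly // vsum0 coef1. Qed.

Lemma vpolyD j L1 L2 :
  eqX M (vpoly j (L1 + L2)) (vpoly j L1 * vpoly (j + L1) L2).
Proof.
move=> n hn; rewrite coef_vpoly // vsumD coefM; apply: eq_bigr => i _.
rewrite !coef_vpoly //; first exact: leq_ltn_trans (leq_subr _ _) hn.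
exact: leq_trans (ltn_ord i) hn.
Qed.

Lemma vpolyM j m : eqX M (vpoly j (k.+1 * m)) (vpoly j k.+1 ^+ m).
Proof.
elim: m => [|m IH]; first by rewrite muln0 expr0; exact: vpoly0.
rewrite mulnS exprS; apply: eqX_trans (vpolyD _ _ _) _.
by rewrite vpoly_period; exact: eqXM.
Qed.

(** The last of [k.+1] trees starting at label [j.+1] has root label congruent to [j]; moving its
    factor to the front gives the group starting at [j]. *)
Lemma vpoly_rot j : eqX M (vpoly j k.+1) (vpoly 0 k.+1).
Proof.
elim: j => // j IH; apply: eqX_trans IH.
have := vpolyD j.+1 k 1; rewrite addn1 addSnnS vpoly_period => h.
apply: eqX_trans h _; rewrite mulrC.
by apply: eqX_sym; have := vpolyD j 1 k; rewrite add1n addn1.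
Qed.

Let y : {poly K} := 'X * vpoly 0 k.+1.

(** A root with [k.+1 * m] children carries [m] groups of [k.+1] consecutive subtrees. Each group
    contributes one factor [y], whatever its first label, by [vpoly_rot]. *)
Lemma vpoly1 j :
  eqX M (vpoly j 1) (\sum_(m < M) vweight j (k.+1 * m) *: y ^+ m).
Proof.
move=> n hn; rewrite coef_vpoly // coef_sum vsumS.
rewrite (big_ord_widen _ (fun m => vweight j (k.+1 * m) *
  vsum (n - m) j.+1 (k.+1 * m)) hn) big_mkcond.
apply: eq_bigr => -[m hm] _ /=.
rewrite coefZ exprMn coefXnM ltnS.
case: leqP => [le_mn|_]; last by rewrite mulr0.
congr (_ * _).
have hnm : (n - m < M)%N by apply: leq_ltn_trans (leq_subr _ _) hn.
rewrite -coef_vpoly // vpolyM //; apply: (eqXX m (vpoly_rot _) _).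
exact: hnm.
Qed.

End Truncation.

Section FunctionalEquation.
Variable M : nat.

Let y : {poly K} := 'X * vpoly M.+1 0 k.+1.

Lemma vpoly_A j : (j != 1 %[mod k.+1])%N ->
  eqX M.+1 (vpoly M.+1 j 1) (tpoly t M \Po y).
Proof.
move=> hj; apply: eqX_trans (vpoly1 _) _.
rewrite /tpoly linear_sum /=; apply: eqX_sum => m.
by rewrite comp_polyZ comp_Xn_poly /vweight (negbTE hj) dvdn_mulr // mulKn.
Qed.

Lemma vpoly_B : (0 < M)%N -> eqX M.+1 (vpoly M.+1 1 1) ((1 + 'X) \Po y).
Proof.
rewrite /y; case: M => // M' _; apply: eqX_trans (vpoly1 _) _.
(* A vertex with label 1 allows only [m = 0] and [m = 1]; the latter is in range because [M] is
   positive. *)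
rewrite comp_polyD comp_polyC comp_polyX 2!big_ord_recl big1 => [|i _].
  rewrite addr0 /vweight eqxx muln0 muln1 !eqxx orbT !scale1r.
  by rewrite expr0 expr1.
rewrite /vweight eqxx muln_eq0 /= -[X in (_ == X)%N]muln1 eqn_mul2l /=.
by rewrite scale0r.
Qed.

Definition vphi : {poly K} := tpoly t M ^+ k * (1 + 'X).

(** Start the group at label 1: its first tree gives B = 1 + y, and the other [k] trees each give A
    = T(y). *)
Lemma vpoly_eq : (0 < M)%N -> eqX M.+1 y ('X * (vphi \Po y)).
Proof.
move=> M_gt0; apply: eqXM => //; apply: eqX_trans (eqX_sym (vpoly_rot 1)) _.
have hD := @vpolyD M.+1 1 1 k; rewrite add1n in hD.
apply: eqX_trans hD _.
rewrite /vphi comp_polyM mulrC comp_poly_exp.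
apply: eqXM (vpoly_B M_gt0).
(* The bound [i <= k] keeps the labels between 2 and [k.+1], none of them congruent to 1. *)
have h i : (i <= k)%N -> eqX M.+1 (vpoly M.+1 2 i) ((tpoly t M \Po y) ^+ i).
  elim: i => [_|i IH hi]; first by rewrite expr0; exact: vpoly0.
  rewrite -[i.+1]addn1 exprD expr1; apply: eqX_trans (vpolyD _ _ _) _.
  apply: eqXM; first by apply: IH; exact: ltnW.
  apply: vpoly_A; rewrite add2n -[i.+2]addn1 -[X in (_ != X %[mod _])%N]add0n.
  by rewrite eqn_modDr !modn_small.
exact: h.
Qed.

End FunctionalEquation.
End Valid.

(** * Coefficient extraction by Lagrange inversion *)

Lemma coef_1DXn (K : comNzRingType) (e i : nat) :
  (((1 + 'X) ^+ e : {poly K})`_i = 'C(e, i)%:R)%R.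
Proof.
rewrite addrC exprD1n coef_sum.
have [h|h] := ltnP i e.+1.
  rewrite (bigD1 (Ordinal h)) //= coefMn coefXn eqxx big1 ?addr0 // => j ne.
  rewrite coefMn coefXn (_ : (i == j) = false) ?mul0rn //.
  by apply: contraNF ne => /eqP e'; apply/eqP/val_inj.
rewrite bin_small // big1 // => -[j hj] _ /=.
by rewrite coefMn coefXn gtn_eqF ?mul0rn // (leq_trans hj).
Qed.

Lemma coef_deriv_Xn_1DXn (K : comNzRingType) (s e n : nat) : (0 < n)%N ->
  ((('X^s)^`() * (1 + 'X) ^+ e : {poly K})`_n.-1)%R =
  s%:R * (if (s <= n)%N then 'C(e, n - s)%:R else 0).
Proof.
case: n => // n _; rewrite derivXn mulrnAl coefMn coefXnM [RHS]mulr_natl.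
case: s => [|s]; first by rewrite !mulr0n.
by rewrite subSS [n.+1.-1]/= ltnS; case: leqP => _; rewrite ?coef_1DXn.
Qed.

Section Coefficients.
Variables (K : fieldType) (t : nat -> K) (k : nat).
Hypotheses (k_gt0 : (0 < k)%N) (t0 : t 0%N = 1) (char0 : [pchar K] =i pred0).

Section Fixn.
Variable n : nat.
Hypothesis n_gt0 : (0 < n)%N.

Let y : {poly K} := 'X * vpoly t k n.+1 0 k.+1.
Let phi := vphi t k n.
Let T := tpoly t n.

Lemma natr_neq0 m : (0 < m)%N -> m%:R != 0 :> K.
Proof. by move/pcharf0P: char0 => ->; rewrite lt0n. Qed.

Lemma lagrange_vpoly (H : {poly K}) :
  (H \Po y)`_n = n%:R^-1 * (H^`() * phi ^+ n)`_n.-1.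
Proof.
have h := lagrange_inversion char0 (vpoly_eq t k n_gt0) H n_gt0 (ltnSn n).
by rewrite -h -[_`_n *+ n]mulr_natl mulKf // natr_neq0.
Qed.

Lemma phiXn : phi ^+ n = T ^+ (k * n) * (1 + 'X) ^+ n.
Proof. by rewrite /phi /vphi exprMn -exprM. Qed.

Lemma one_neq0_mod : (0 != 1 %[mod k.+1])%N.
Proof. by rewrite !modn_small. Qed.

(** This is the source of the denominator kn + 1 in the formulas for A and AB. *)
Lemma deriv_T :
  T^`() * T ^+ (k * n) = (k * n + 1)%:R^-1 *: (T ^+ (k * n + 1))^`().
Proof.
rewrite deriv_exp addn1 /= -scaler_nat scalerA mulVf ?scale1r //.
exact: natr_neq0.
Qed.

(** A single list of partitions serves both exponents that occur, kn and kn + 1. *)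
Lemma coef_expansion r (p : {poly K}) : (r <= k * n + 1)%N ->
  (T ^+ r * p)`_n.-1 =
  \sum_(s <- partseqs (k * n + 1) n) mnweight t n r s * ('X^(sumn s) * p)`_n.-1.
Proof.
move=> hr; rewrite (tpoly_exp t0 char0 n hr) mulr_suml coef_sum.
by apply: eq_bigr => s _; rewrite -scalerAl coefZ.
Qed.

Lemma coef_deriv_expansion r (p : {poly K}) : (r <= k * n + 1)%N ->
  ((T ^+ r)^`() * p)`_n.-1 =
  \sum_(s <- partseqs (k * n + 1) n)
    mnweight t n r s * (('X^(sumn s))^`() * p)`_n.-1.
Proof.
move=> hr; rewrite (tpoly_exp t0 char0 n hr) raddf_sum mulr_suml coef_sum.
by apply: eq_bigr => s _; rewrite /= derivZ -scalerAl coefZ.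
Qed.

Lemma coef_Xn_bin s : ('X^s * (1 + 'X) ^+ n : {poly K})`_n.-1 = 'C(n, s + 1)%:R.
Proof.
case: n n_gt0 => // m _; rewrite coefXnM [m.+1.-1]/= coef_1DXn addn1.
case: ltnP => h; first by rewrite bin_small.
by rewrite -[in RHS]bin_sub ?subSS.
Qed.

Lemma coef_deriv_bin s :
  (('X^s)^`() * (1 + 'X) ^+ n : {poly K})`_n.-1 = s%:R * 'C(n, s)%:R.
Proof.
rewrite coef_deriv_Xn_1DXn //; case: leqP => h; first by rewrite bin_sub.
by rewrite bin_small.
Qed.

Lemma coef_deriv_binS s :
  (('X^s)^`() * (1 + 'X) ^+ n.+1 : {poly K})`_n.-1 =
  s%:R * 'C(n + 1, s + 1)%:R.
Proof.
rewrite coef_deriv_Xn_1DXn // !addn1.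
case: leqP => h; last by rewrite bin_small.
by rewrite -[in RHS]bin_sub ?subSS.
Qed.

Lemma vsum_A : vsum t k n 0 1 =
  \sum_(s <- partseqs (k * n + 1) n)
    n%:R^-1 * ((sumn s)%:R / (k * n + 1)%:R) * 'C(n, sumn s)%:R
    * mnweight t n (k * n + 1) s.
Proof.
rewrite -(@coef_vpoly _ _ _ n.+1) // (@vpoly_A _ t k n 0 one_neq0_mod) //.
rewrite lagrange_vpoly.
rewrite phiXn mulrA deriv_T -scalerAl coefZ coef_deriv_expansion // !mulr_sumr.
by apply: eq_bigr => s _; rewrite coef_deriv_bin; ring.
Qed.

Lemma vsum_B : vsum t k n 1 1 =
  \sum_(s <- partseqs (k * n + 1) n)
    n%:R^-1 * 'C(n, sumn s + 1)%:R * mnweight t n (k * n) s.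
Proof.
rewrite -(@coef_vpoly _ _ _ n.+1) // (@vpoly_B _ t k n n_gt0) // lagrange_vpoly.
rewrite phiXn derivD derivC derivX add0r mul1r coef_expansion ?leq_addr //.
by rewrite mulr_sumr; apply: eq_bigr => s _; rewrite coef_Xn_bin; ring.
Qed.

Lemma vsum_AB :
  \sum_(i < n.+1) vsum t k i 0 1 * vsum t k (n - i) 1 1 =
  \sum_(s <- partseqs (k * n + 1) n)
    n%:R^-1 * ('C(n, sumn s + 1)%:R
       + (sumn s)%:R / (k * n + 1)%:R * 'C(n + 1, sumn s + 1)%:R)
    * mnweight t n (k * n + 1) s.
Proof.
transitivity (vpoly t k n.+1 0 1 * vpoly t k n.+1 1 1)`_n.
  rewrite coefM; apply: eq_bigr => i _.
  by rewrite !coef_vpoly // ltnS leq_subr.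
have h := eqXM (@vpoly_A _ t k n 0 one_neq0_mod) (@vpoly_B _ t k n n_gt0).
rewrite h // -comp_polyM lagrange_vpoly phiXn derivM derivD derivC derivX.
(* For H = T (1 + u), H' phi^n is T' T^(kn) (1 + u)^(n+1) + T^(kn+1) (1 + u)^n; the two terms give
   the two binomials of the formula. *)
rewrite add0r mulr1 mulrDl mulrACA deriv_T -exprS -scalerAl.
rewrite mulrA -exprS -[(k * n).+1]addn1 [_ *: _ + _]addrC coefD coefZ.
rewrite coef_expansion // coef_deriv_expansion //.
rewrite mulr_sumr -big_split mulr_sumr; apply: eq_bigr => s _ /=.
by rewrite coef_Xn_bin coef_deriv_binS; ring.
Qed.

End Fixn.
End Coefficients.

(** * From lists of sequences to sums over all partitions *)

Lemma parts_intpart_of (s : seq nat) : sorted geq s -> 0%N \notin s ->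
  parts (intpart_of s) = s.
Proof.
move=> srt s0; rewrite /= (eq_in_filter (a2 := predT)); last first.
  by move=> i hi; rewrite lt0n; apply: contraNneq s0 => <-.
rewrite filter_predT; apply: sorted_sort => // a b c h1 h2.
exact: leq_trans h2 h1.
Qed.

Lemma parts_partseqs M m s : s \in partseqs M m -> parts (intpart_of s) = s.
Proof.
move/partseqsP=> [srt h]; apply: parts_intpart_of => //.
by apply/negP => /h.
Qed.

Lemma leq_sumn (s : seq nat) i : i \in s -> (i <= sumn s)%N.
Proof.
elim: s => //= a s IH; rewrite inE => /predU1P[->|/IH h]; first exact: leq_addr.
by apply: leq_trans h _; exact: leq_addl.
Qed.

(** The length bounds every multiplicity and the size bounds every part, so the support of [f] lies
    in the list. *)
Lemma fsbig_intpart (K : comNzRingType) (M m : nat) (f : intpart -> K) :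
  (forall la, f la != 0 -> (plength la <= M)%N /\ (psize la <= m)%N) ->
  \sum_(la \in [set: intpart]%classic) f la =
  \sum_(s <- partseqs M m) f (intpart_of s).
Proof.
move=> hf; rewrite -(big_map intpart_of xpredT f) [RHS]fsbig_seq; last first.
  rewrite map_inj_in_uniq ?partseqs_uniq // => s1 s2 h1 h2 e.
  by rewrite -(parts_partseqs h1) e (parts_partseqs h2).
apply/esym/fsbig_widen => // la [_ hla].
apply/eqP; apply: contrapT => /negP/hf[hM hm]; apply: hla => /=.
have /andP[srt n0] : sorted geq la && (0%N \notin (la : seq nat)) by case: (la).
apply/mapP; exists (parts la).
  by apply: mem_partseqs => // i /leq_sumn h; apply: leq_trans hm.
by apply/val_inj; exact: esym (parts_intpart_of srt n0).
Qed.

Lemma big_nat_tail (R : Type) (idx : R) (op : Monoid.law idx) (F : nat -> R)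
    (a b m : nat) : (forall i, (m < i)%N -> F i = idx) ->
  (m <= a)%N -> (m <= b)%N ->
  \big[op/idx]_(1 <= i < a.+1) F i = \big[op/idx]_(1 <= i < b.+1) F i.
Proof.
move=> hF; suff h c : (m <= c)%N ->
    \big[op/idx]_(1 <= i < c.+1) F i = \big[op/idx]_(1 <= i < m.+1) F i.
  by move=> /h -> /h ->.
move=> le_mc; rewrite (@big_cat_nat _ _ _ m.+1) //=.
have -> : \big[op/idx]_(m.+1 <= i < c.+1) F i = idx.
  by rewrite big_nat_cond big1 // => i; rewrite andbT => /andP[/hF].
by rewrite Monoid.mulm1.
Qed.

Lemma count_mem_gt (s : seq nat) m i : {in s, forall j, (j <= m)%N} ->
  (m < i)%N -> count_mem i s = 0%N.
Proof.
move=> hs hi; apply/count_memPn; apply: contraTN hi => /hs.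
by rewrite -leqNgt.
Qed.

(** The two products stop at the size of [s] and at [m]; every factor beyond the smaller bound is 0!
    = 1. *)
Lemma pfact_partseqs M m s : s \in partseqs M m ->
  pfact (intpart_of s) = cntfact m s.
Proof.
move=> hs; rewrite /pfact /psize /pmult (parts_partseqs hs).
have hm : {in s, forall i, (i <= m)%N}.
  by have [_ h] := partseqsP hs => i /h/andP[].
have hs' : {in s, forall i, (i <= minn m (sumn s))%N}.
  by move=> i hi; rewrite leq_min hm // leq_sumn.
apply: (@big_nat_tail _ _ _ _ _ _ (minn m (sumn s)));
  rewrite ?geq_minl ?geq_minr //.
by move=> i /(count_mem_gt hs') ->.
Qed.

Lemma prod_count_mem (K : comNzRingType) (t : nat -> K) (s : seq nat) m :
  {in s, forall i, (0 < i <= m)%N} ->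
  \prod_(i <- s) t i = \prod_(1 <= i < m.+1) t i ^+ count_mem i s.
Proof.
elim: s => [|a s IH] hs; first by rewrite big_nil big1.
rewrite big_cons IH => [|i hi]; last by apply: hs; rewrite inE hi orbT.
under [RHS]eq_bigr => i _ do rewrite exprD.
rewrite big_split; congr (_ * _).
rewrite (bigD1_seq a) ?iota_uniq ?mem_index_iota /=; last 2 first.
- exact: hs (mem_head _ _).
- by [].
rewrite eqxx expr1 big1 ?mulr1 // => i /negbTE h.
by rewrite eq_sym h.
Qed.

(** * The coefficient field and the link with valid trees *)

Section Ratfield.
Variable R : realType.

(** The value 1 at index 0 replaces the junk variable, so leaves, which the type ignores, have
    weight 1. *)
Definition tvar1 (i : nat) : ratfield R := if i == 0%N then 1 else tvar R i.

Lemma tmon_parts (la : intpart) : tmon R la = \prod_(i <- parts la) tvar1 i.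
Proof.
rewrite (@prod_count_mem _ _ _ (psize la)) => [|i hi].
  by apply: eq_big_nat => i /andP[i_gt0 _]; rewrite /tvar1 gtn_eqF.
rewrite leq_sumn // andbT lt0n.
by apply: contraTneq hi => ->; case: la => s /= /andP[].
Qed.

Lemma tmon_intpart_of (s : seq nat) :
  tmon R (intpart_of s) = \prod_(i <- s) tvar1 i.
Proof.
rewrite tmon_parts /= (perm_big [seq m <- s | (0 < m)%N]) /=; last first.
  by rewrite perm_sort.
rewrite big_filter big_mkcond; apply: eq_bigr => i _.
by rewrite lt0n /tvar1; case: eqP.
Qed.

Lemma ratfield_char0 : [pchar (ratfield R)] =i pred0.
Proof.
apply/pcharf0P => n; apply/eqP/eqP => [|->] //.
move/eqP; rewrite -(rmorph_nat (@FracField.tofrac (ipoly R[i]))).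
rewrite tofrac_eq0 => /eqP /(congr1 (mcoeff mone)).
rewrite mcoeff0 -mpolyC_nat malgCK => /eqP.
by rewrite pnatr_eq0 => /eqP.
Qed.

End Ratfield.

Lemma label1E j k i : label1 j k i = (j + i == 1 %[mod k.+1])%N.
Proof. by []. Qed.

Lemma dweight_tree (R : realType) (k j n : nat) (T : ptree) :
  nvertices T = (k.+1 * n).+1 ->
  dweight (vweight (tvar1 R) k) j (degseq T) =
  if valid_tree j n k T then tmon R (tree_type j k T) else 0.
Proof.
move=> hT; rewrite dweightE size_degseq.
(* The edge condition of validity follows from the vertex count, leaving only the local degree
   conditions. *)
have hE : nedges T = (k.+1 * n)%N.
  by apply: succn_inj; rewrite -nvertices_nedges.
pose ok i := let d := nchildren T i in
  if label1 j k i then (d == 0%N) || (d == k.+1) else (k.+1 %| d)%N.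
have -> : valid_tree j n k T = all ok (iota 0 (nvertices T)).
  by rewrite /valid_tree hE {1}hT !eqxx.
case: allP => [hall|hn].
  rewrite /tree_type tmon_intpart_of big_map big_filter [RHS]big_mkcond.
  rewrite !big_seq; apply: eq_bigr => i /hall.
  by rewrite /ok -nchildrenE /vweight -label1E; case: (label1 j k i) => /= ->.
have [i hi hd] : exists2 i, i \in iota 0 (nvertices T) & ~~ ok i.
  by apply/allPn/allP.
rewrite (big_rem i hi) /= -nchildrenE /vweight -label1E.
by move: hd; rewrite /ok; case: (label1 j k i) => /= /negbTE ->; rewrite mul0r.
Qed.

Lemma treeGF_vsum (R : realType) (k j n : nat) :
  treeGF R k j n = vsum (tvar1 R) k n j 1.
Proof.
(* Trees with the right number of vertices are listed as the one-tree forests. *)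
pose r := [seq head (PNode [::]) F | F <- forests (k.+1 * n + 1) 1].
have hr T : (T \in r) = (nvertices T == (k.+1 * n).+1).
  apply/mapP/eqP => [[F]|hT].
    rewrite mem_forests => /andP[/eqP]; case: F => [|T' [|//]] // _ /eqP h ->.
    by rewrite -size_degseq -addn1 -h /fdegseq /= cats0.
  exists [:: T] => //.
  by rewrite mem_forests /fdegseq /= cats0 size_degseq hT addn1 eqxx.
have ur : uniq r.
  rewrite map_inj_in_uniq ?forests_uniq // => F1 F2.
  rewrite !mem_forests => /andP[/eqP + _] /andP[/eqP + _].
  by case: F1 F2 => [|T1 [|//]] // [|T2 [|//]] // _ _ /= ->.
rewrite /treeGF /vsum /fsum.
have -> : [set T | valid_tree j n k T]%classic =
    [set` [seq T <- r | valid_tree j n k T]]%classic.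
  apply/seteqP; split=> T /=; rewrite mem_filter hr; last by case/andP.
  by move=> h; rewrite h; case/and3P: h.
rewrite -fsbig_seq ?filter_uniq // big_filter big_mkcond big_map.
rewrite !big_seq; apply: eq_bigr => F hF.
have := map_f (head (PNode [::])) hF; rewrite hr => /eqP hv.
rewrite -dweight_tree //; move: hF; rewrite mem_forests => /andP[/eqP].
by case: F hv => [|T [|//]] // _ _ _; rewrite /fdegseq /= cats0.
Qed.

Lemma mnweight_partseqs (R : realType) (M n r : nat) s : s \in partseqs M n ->
  'C(r, plength (intpart_of s))%:R
    * ((plength (intpart_of s))`!%:R / (pfact (intpart_of s))%:R)
    * tmon R (intpart_of s) = mnweight (tvar1 R) n r s.
Proof.
move=> hs; rewrite (pfact_partseqs hs) tmon_parts (parts_partseqs hs).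
rewrite /plength (parts_partseqs hs) /mnweight -bin_ffact natrM.
by rewrite !mulrA.
Qed.

(** The support is finite: [g] kills sizes above [n], and the binomial coefficient kills lengths
    above [r]. *)
Lemma sum_partseqs (R : realType) (n r M : nat) (g : nat -> ratfield R) :
  (r <= M)%N -> (forall s, (n < s)%N -> g s = 0) ->
  \sum_(la \in [set: intpart]%classic)
     g (psize la) * 'C(r, plength la)%:R
     * ((plength la)`!%:R / (pfact la)%:R) * tmon R la =
  \sum_(s <- partseqs M n) g (sumn s) * mnweight (tvar1 R) n r s.
Proof.
move=> hr hg; rewrite (@fsbig_intpart _ M n) => [|la].
  rewrite !big_seq; apply: eq_bigr => s hs.
  by rewrite -(mnweight_partseqs R r hs) {1}/psize (parts_partseqs hs) !mulrA.
move=> h; split; rewrite leqNgt; apply: contraNN h => h.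
  by rewrite bin_small ?mulr0 ?mul0r ?eqxx // (leq_ltn_trans hr).
by rewrite hg // !mul0r.
Qed.

Theorem mainTheorem3 (R : realType) (k : nat) (hk : (1 <= k)%N) :
  [/\ Aseries R k = fps_onep (fun n =>
        \sum_(la \in [set: intpart]%classic)
          n%:R^-1 * ((psize la)%:R / (k * n + 1)%:R)
          * 'C(n, psize la)%:R * 'C(k * n + 1, plength la)%:R
          * ((plength la)`!%:R / (pfact la)%:R) * tmon R la),
      Bseries R k = fps_onep (fun n =>
        \sum_(la \in [set: intpart]%classic)
          n%:R^-1
          * 'C(n, psize la + 1)%:R * 'C(k * n, plength la)%:R
          * ((plength la)`!%:R / (pfact la)%:R) * tmon R la) &
      fps_mul (Aseries R k) (Bseries R k) = fps_onep (fun n =>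
        \sum_(la \in [set: intpart]%classic)
          n%:R^-1
          * ('C(n, psize la + 1)%:R
             + (psize la)%:R / (k * n + 1)%:R * 'C(n + 1, psize la + 1)%:R)
          * 'C(k * n + 1, plength la)%:R
          * ((plength la)`!%:R / (pfact la)%:R) * tmon R la)].
Proof.
have t0 : tvar1 R 0 = 1 by [].
have char0 := @ratfield_char0 R.
(* The only tree without edges is a single leaf, of weight 1 for every root label. *)
have vsum01 j : vsum (tvar1 R) k 0 j 1 = 1.
  rewrite vsumS big_ord_recl big_ord0 addr0 muln0 vsum0 mulr1 /vweight.
  by case: ifP; rewrite ?eqxx ?dvdn0 ?div0n.
split; apply/funext => n; rewrite /fps_onep; case: posnP => [->|n_gt0].
- by rewrite /Aseries treeGF_vsum vsum01.
- rewrite /Aseries treeGF_vsum (vsum_A hk t0 char0 n_gt0).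
  rewrite (sum_partseqs (n := n) (g := fun s => n%:R^-1 *
    (s%:R / (k * n + 1)%:R) * 'C(n, s)%:R) (leqnn _)) // => s hs.
  by rewrite bin_small ?mulr0.
- by rewrite /Bseries treeGF_vsum vsum01.
- rewrite /Bseries treeGF_vsum (vsum_B k t0 char0 n_gt0).
  rewrite (sum_partseqs (n := n) (g := fun s => n%:R^-1 * 'C(n, s + 1)%:R)
    (leq_addr 1 _)) // => s hs.
  by rewrite bin_small ?mulr0 // addn1 ltnW.
- by rewrite /fps_mul big_ord_recl big_ord0 addr0 /Aseries /Bseries !treeGF_vsum
    !vsum01 mulr1.
rewrite /fps_mul /Aseries /Bseries.
under eq_bigr => i _ do rewrite !treeGF_vsum.
rewrite (vsum_AB hk t0 char0 n_gt0).
rewrite (sum_partseqs (n := n) (g := fun s => n%:R^-1 * ('C(n, s + 1)%:R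
  + s%:R / (k * n + 1)%:R * 'C(n + 1, s + 1)%:R)) (leqnn _)) // => s hs.
by rewrite !bin_small ?mulr0 ?addr0 ?mulr0 // !addn1 // ltnW.
Qed.
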